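(* Let $\ell\ge1$ be an integer, $p>0$, $q=1-p$, $p<q$, and $\rho=p/q$. The stationary distribution $(\pi_n)_{n\ge0}$ of $P_\ell$ satisfies $$\pi_n\sim c(\ell,p)\,\rho^{2n}\qquad\text{as } n\to\infty,$$ where $$c(\ell,p)=(\mu_1-1)\,\mu_1^{-1}\prod_{2\le\nu\le\ell}(1-\mu_\nu)(\mu_1-\mu_\nu)^{-1}.$$
   Context: For $-\ell\le j\le\ell$ put $p_j=\binom{2\ell}{\ell+j}p^{\ell+j}q^{\ell-j}$, and $p_j=0$ for $|j|>\ell$. $P_\ell$ is the transition matrix of the Markov chain on $\{0,1,2,\ldots\}$ with $(P_\ell)_{n,m}=p_{m-n}$ for $m\ge1$, $n\ge0$, and $(P_\ell)_{n,0}=\sum_{i\le -n}p_i=p_{-n}+\cdots+p_{-\ell}$ for $0\le n\le\ell$, $(P_\ell)_{n,0}=0$ for $n>\ell$. Since $p<q$, the chain is positive recurrent; $(\pi_n)_{n\ge0}$ denotes its unique stationary probability distribution. Let $\omega_\ell=e^{2\pi \mathbf i/\ell}$. For $1\le j\le\ell$, $\mu_j$ is the root of larger modulus of the quadratic polynomial $s_j(z)=(pz+q)^2-\omega_\ell^{j-1}z$; exactly one root of $s_j$ has modulus strictly greater than $1$, and it is $\mu_j$; in particular $\mu_1=(q/p)^2$. An empty product equals $1$. Here $a_n\sim b_n$ means $a_n/b_n\to1$. *)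

(* Defs.v *)
From HB Require Import structures.
From mathcomp Require Import all_boot all_order all_algebra.
From mathcomp Require Import complex.
From mathcomp Require Import all_classical all_reals all_analysis.

Set Implicit Arguments.
Unset Strict Implicit.
Unset Printing Implicit Defensive.

Import Order.TTheory GRing.Theory Num.Theory.
Import numFieldNormedType.Exports.

Local Open Scope classical_set_scope.
Local Open Scope ring_scope.
Local Open Scope complex_scope.

Section Chain.
Variable R : realType.
Implicit Types (l j n m : nat) (p q : R).

(* p_j, for j ranging over the integers; on the support |j| <= l the absolute
   values `|l + j| and `|l - j| are just l + j and l - j as naturals. *)
Definition step l p q (j : int) : R :=
  if (`|j| <= l)%N
  then 'C(l.*2, `|l%:Z + j|)%:R * p ^+ `|l%:Z + j| * q ^+ `|l%:Z - j|
  else 0.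

(* The sum in the column m = 0 is empty for n > l. *)
Definition trans l p q n m : R :=
  if m is 0%N then \sum_(n <= k < l.+1) step l p q (- k%:Z)
  else step l p q (m%:Z - n%:Z).

Definition stationary_distribution (P : nat -> nat -> R) (w : nat -> R) : Prop :=
  [/\ forall n, 0 <= w n,
      series w @ \oo --> (1 : R) &
      forall m, series (fun n => w n * P n m) @ \oo --> w m].

(* e^(2 pi i / l) *)
Definition omega l : R[i] :=
  let t := 2 * pi / l%:R in cos t +i* sin t.

Definition s_poly l p q j : {poly R[i]} :=
  (p%:C *: 'X + (q%:C)%:P) ^+ 2 - omega l ^+ j.-1 *: 'X.

Definition largest_root (f : {poly R[i]}) (z : R[i]) : Prop :=
  root f z /\ forall w, root f w -> `|w| <= `|z|.

(* When 0 < p < q = 1 - p, the two roots of [s_poly l p q j] have distinct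
   moduli, so exactly one root satisfies the predicate and [xget] selects it. *)
Definition mu l p q j : R[i] := xget 0 [set z | largest_root (s_poly l p q j) z].

Definition c_const l p q : R[i] :=
  (mu l p q 1 - 1) * (mu l p q 1)^-1 *
  \prod_(2 <= nu < l.+1) ((1 - mu l p q nu) * (mu l p q 1 - mu l p q nu)^-1).

End Chain.

(* a_n / b_n --> 1 *)
Definition asymp_equiv (K : numFieldType) (a b : nat -> K) : Prop :=
  (fun n => a n / b n) @ \oo --> (1 : K).

(* Main.v *)
Require Import Defs.
From mathcomp Require Import all_boot all_order all_algebra.
From mathcomp Require Import complex.
From mathcomp Require Import all_classical all_reals all_analysis.
From mathcomp Require Import ring lra zify.
Import Order.TTheory GRing.Theory Num.Theory.
Import numFieldNormedType.Exports.
Local Open Scope ring_scope.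
Local Open Scope complex_scope.
Local Open Scope classical_set_scope.

Set Implicit Arguments.
Unset Strict Implicit.
Unset Printing Implicit Defensive.

(** The generating function W of the stationary law satisfies
    ((pX+q)^(2l) - X^l) W = N with N a polynomial of degree at most l: this is
    [stationary_pconv], the balance equations away from the boundary state.
    The l-th roots of unity split the left factor into the l quadratics
    (pX+q)^2 - omega^j X ([prod_sub_unity]), and each of them has one root mu_j
    outside the closed unit disc and one root (q/p)^2 / mu_j inside it
    ([charpoly_factor], [quad_largest_norm]).  Since the coefficients of W tend
    to 0, the factors belonging to the inner roots can be cancelled one at a
    time, each cancellation lowering the degree of the right-hand side by one
    ([pconv_prod_eq0]); after l of them only a constant is left:
    prod_j (X - mu_j) W = c0.  Summing coefficients and using W(1) = 1 gives
    c0 = prod_j (1 - mu_j).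

    The root mu_1 = (q/p)^2 is real and strictly smallest in modulus among the
    mu_j ([mu_gt_first]), because equality in |pz+q| <= p|z|+q forces z > 0.
    Hence prod_(j >= 2) (X - mu_j) W = c0 / (X - mu_1) has exactly geometric
    coefficients, and dividing by a factor X - mu_j with |mu_j| > mu_1 keeps the
    rate mu_1^(-n), the limit being divided by mu_1 - mu_j ([mulXsub_asymp]).

    Everything is done on coefficient sequences, so that no complex analysis is
    involved: [pconv P x] is the sequence of coefficients of P times the power
    series with coefficients x. *)

(** * Multiplying a power series by a polynomial *)

(** The coefficients of (X - r) times the power series with coefficients [x]. *)
Definition mulXsub (K : nzRingType) (r : K) (x : nat -> K) (n : nat) : K :=
  (if n is m.+1 then x m else 0) - r * x n.

Definition pconv (K : nzRingType) (P : {poly K}) (x : nat -> K) (n : nat) : K :=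
  \sum_(k < n.+1) P`_k * x (n - k)%N.

Lemma pconvXsub (K : comNzRingType) (r : K) (P : {poly K}) (x : nat -> K) (n : nat) :
  pconv (('X - r%:P) * P) x n = mulXsub r (pconv P x) n.
Proof.
rewrite /pconv /mulXsub mulrBl.
under eq_bigr => k _ do rewrite coefB coefXM coefCM mulrBl -mulrA.
rewrite big_split /= sumrN -mulr_sumr; congr (_ - _).
case: n => [|n]; first by rewrite big_ord1 mul0r.
by rewrite big_ord_recl /= mul0r add0r; apply: eq_bigr => k _.
Qed.

Lemma pconvZ (K : nzRingType) (c : K) (P : {poly K}) (x : nat -> K) (n : nat) :
  pconv (c *: P) x n = c * pconv P x n.
Proof. by rewrite mulr_sumr; apply: eq_bigr => k _; rewrite coefZ mulrA. Qed.

Lemma pconvB (K : nzRingType) (P Q : {poly K}) (x : nat -> K) (n : nat) :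
  pconv (P - Q) x n = pconv P x n - pconv Q x n.
Proof. by rewrite -sumrB; apply: eq_bigr => k _; rewrite coefB mulrBl. Qed.

Lemma pconv1 (K : nzRingType) (x : nat -> K) : pconv 1 x = x.
Proof.
apply/funext => n; rewrite /pconv big_ord_recl big1 ?addr0 /= ?coef1 ?mul1r ?subn0 //.
by move=> k _; rewrite coef1 mul0r.
Qed.

Lemma pconvXn (K : nzRingType) (d : nat) (x : nat -> K) (n : nat) :
  (d <= n)%N -> pconv 'X^d x n = x (n - d)%N.
Proof.
rewrite -ltnS => dn; rewrite /pconv (bigD1 (Ordinal dn)) //= coefXn eqxx mul1r big1 ?addr0 //.
by move=> k /negPf; rewrite -val_eqE /= coefXn => ->; rewrite mul0r.
Qed.

Lemma cvg_mulXsub (K : numFieldType) (r s : K) (x : nat -> K) :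
  x @ \oo --> s -> mulXsub r x @ \oo --> (1 - r) * s.
Proof.
move=> xs; rewrite -cvg_shiftS mulrBl mul1r.
apply: cvgB => //; apply: cvgM; first exact: cvg_cst.
by rewrite (cvg_shiftS x).
Qed.

Lemma cvg_pconv_prod (K : numFieldType) (I : Type) (s : seq I) (r : I -> K)
    (P : {poly K}) (x : nat -> K) :
  pconv P x @ \oo --> (0 : K) ->
  pconv (\prod_(j <- s) ('X - (r j)%:P) * P) x @ \oo --> (0 : K).
Proof.
move=> Px0; elim: s => [|j s IHs]; first by rewrite big_nil mul1r.
rewrite big_cons -mulrA (funext (pconvXsub _ _ _)).
by rewrite -(mulr0 (1 - r j)); exact: cvg_mulXsub.
Qed.

(** * Cancelling roots of the unit disc *)

(** Beyond [d] the hypothesis reads x_(n-1) = r x_n, so |x| is nondecreasing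
    there; being nondecreasing with limit 0, it vanishes. *)
Lemma mulXsub_eq0 (K : numFieldType) (r : K) (x : nat -> K) (d : nat) :
  `|r| <= 1 -> x @ \oo --> (0 : K) ->
  (forall n, (d < n)%N -> mulXsub r x n = 0) ->
  forall n, (d <= n)%N -> x n = 0.
Proof.
move=> r1 x0 rx n dn.
have xle k : `|x n| <= `|x (n + k)%N|.
  elim: k => [|k IHk]; first by rewrite addn0.
  apply: (le_trans IHk); have /eqP := rx (n + k).+1 ltac:(lia).
  rewrite /mulXsub subr_eq0 => /eqP ->; rewrite addnS normrM.
  by rewrite ler_piMl.
apply/eqP; rewrite -normr_eq0; apply/negPn/negP => xn0.
have {xn0} xn_gt0 : 0 < `|x n| by rewrite lt_def xn0 /=.
have /cvgrPdist_lt /(_ _ xn_gt0) [N _ /(_ (n + N)%N)] := x0.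
rewrite /= leq_addl sub0r normrN => /(_ isT).
by move=> /(le_lt_trans (xle N)); rewrite ltxx.
Qed.

(** Repeated roots are harmless: each factor is cancelled on its own and costs
    one degree. *)
Lemma pconv_prod_eq0 (K : numFieldType) (I : Type) (s : seq I) (r : I -> K)
    (P : {poly K}) (x : nat -> K) (d : nat) :
  (forall j, `|r j| <= 1) -> pconv P x @ \oo --> (0 : K) ->
  (forall n, (d + size s <= n)%N ->
     pconv (\prod_(j <- s) ('X - (r j)%:P) * P) x n = 0) ->
  forall n, (d <= n)%N -> pconv P x n = 0.
Proof.
move=> r1 Px0; elim: s => [|j s IHs] /= Px.
  by move=> n dn; rewrite -(Px n) ?addn0 // big_nil mul1r.
apply: IHs; apply: (@mulXsub_eq0 _ (r j) (pconv _ x)) => // [|m ms].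
  exact: cvg_pconv_prod.
by rewrite -pconvXsub; have := Px m; rewrite big_cons -mulrA; apply; rewrite addnS.
Qed.

(** * Sums and geometric sequences *)

(** Partial summation is multiplication by X/(1 - X), hence commutes with
    multiplication by X - r. *)
Lemma series_mulXsub (K : numFieldType) (r : K) (x : nat -> K) :
  series (mulXsub r x) = mulXsub r (series x).
Proof.
have s0 (y : nat -> K) : series y 0%N = 0 by rewrite /series /= big_geq.
apply/funext => n; elim: n => [|n IHn]; first by rewrite /mulXsub !s0 mulr0 subr0.
rewrite seriesSr IHn /mulXsub (seriesSr x).
case: n {IHn} => [|n]; first by rewrite !s0; ring.
by rewrite (seriesSr x); ring.
Qed.

(** Evaluation at 1 of the product of a polynomial and a power series. *)
Lemma series_pconv_prod (K : numFieldType) (I : Type) (s : seq I) (r : I -> K)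
    (t : K) (x : nat -> K) :
  series x @ \oo --> t ->
  series (pconv (\prod_(j <- s) ('X - (r j)%:P)) x) @ \oo
    --> \prod_(j <- s) (1 - r j) * t.
Proof.
move=> xt; elim: s => [|j s IHs]; first by rewrite !big_nil pconv1 mul1r.
rewrite !big_cons (funext (pconvXsub _ _ _)) -mulrA series_mulXsub.
exact: cvg_mulXsub.
Qed.

Lemma series_eventually0 (K : numFieldType) (x : nat -> K) (N : nat) (t : K) :
  series x @ \oo --> t -> (forall n, (N <= n)%N -> x n = 0) ->
  \sum_(i < N) x i = t.
Proof.
move=> + x0; rewrite -(cvg_shiftn N).
have -> : [sequence series x (n + N)%N]_n = (fun=> \sum_(i < N) x i).
  apply/funext => n; rewrite /series /= addnC big_mkord big_split_ord /=.
  by rewrite [X in _ + X]big1 ?addr0 // => i _; rewrite x0 ?leq_addr.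
by move/(cvg_unique (@norm_hausdorff _ _) (cvg_cst _)).
Qed.

Lemma mulXsub_geometric (K : fieldType) (m c : K) (x : nat -> K) :
  m != 0 -> mulXsub m x 0%N = c -> (forall n, (1 <= n)%N -> mulXsub m x n = 0) ->
  forall n, x n * m ^+ n = - c / m.
Proof.
move=> m0 xc x0; elim=> [|n IHn].
  by rewrite -xc /mulXsub sub0r opprK expr0 mulr1 mulrC mulKf.
have /eqP := x0 n.+1 isT; rewrite /mulXsub subr_eq0 => /eqP xn.
by rewrite exprS mulrA [x _ * m]mulrC -xn.
Qed.

(** * Asymptotics of a quotient by X - r *)

(** The complex numbers seen as a [numFieldType], whose topology is the one that
    [asymp_equiv] refers to. *)
Definition Cfield (R : realType) : numFieldType := R[i].

Lemma cvg_real_complex (R : realType) (x : nat -> R) (t : R) :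
  x @ \oo --> t -> (fun n => (x n)%:C : Cfield R) @ \oo --> (t%:C : Cfield R).
Proof.
move=> /cvgrPdist_lt xt; apply/cvgrPdist_lt => -[e1 e2].
rewrite ltcE /= => /andP[/eqP -> e1_gt0].
have := xt _ e1_gt0; apply: filterS => n.
by rewrite -rmorphB normc_def /= expr0n /= addr0 sqrtr_sqr ltcR.
Qed.

Lemma cvg_expC (R : realType) (a : Cfield R) :
  `|a| < 1 -> (fun n => `|a| ^+ n) @ \oo --> (0 : Cfield R).
Proof.
rewrite normc_def -[1]/(1%:C) ltcR; set b := Num.sqrt _ => b1.
have b0 : 0 <= b by exact: sqrtr_ge0.
have /cvg_real_complex : (fun n => b ^+ n) @ \oo --> (0 : R).
  by apply: cvg_expr; rewrite ger0_norm.
by under eq_fun do rewrite rmorphXn.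
Qed.

(** Once |d| <= (1 - |a|) h / 2, induction gives
    |e_(k+N)| <= |a|^k |e_N| + h / 2. *)
Lemma cvg_contraction (K : numFieldType) (a : K) (e d : nat -> K) :
  `|a| < 1 -> (fun n => `|a| ^+ n) @ \oo --> (0 : K) ->
  (forall n, e n.+1 = a * e n + d n) -> d @ \oo --> (0 : K) ->
  e @ \oo --> (0 : K).
Proof.
move=> a1 an0 eS d0; apply/cvgrPdist_lt => h h0.
have h2 : 0 < h / 2 by rewrite divr_gt0.
have a1' : 0 < 1 - `|a| by rewrite subr_gt0.
have /cvgrPdist_lt /(_ _ (mulr_gt0 h2 a1')) [N _ dN] := d0.
have eN k : `|e (k + N)%N| <= `|a| ^+ k * `|e N| + h / 2.
  elim: k => [|k IHk]; first by rewrite expr0 mul1r add0n lerDl ltW.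
  rewrite addSn eS (le_trans (ler_normD _ _)) // normrM.
  have := dN (k + N)%N (leq_addl _ _); rewrite sub0r normrN => /ltW dk.
  apply: le_trans (lerD (ler_wpM2l (normr_ge0 a) IHk) dk) _.
  by rewrite le_eqVlt; apply/orP; left; apply/eqP; rewrite exprS; ring.
have : (fun n => `|a| ^+ n * `|e N|) @ \oo --> (0 : K).
  by rewrite -(mul0r `|e N|); apply: cvgM => //; exact: cvg_cst.
move=> /cvgrPdist_lt /(_ _ h2) [M _ aM].
exists (M + N)%N => // n /= Mn; rewrite sub0r normrN.
have := aM (n - N)%N; rewrite /= sub0r normrN ger0_norm ?mulr_ge0 ?exprn_ge0 //.
move=> /(_ ltac:(lia)) lt1.
have := eN (n - N)%N; rewrite subnK ?(leq_trans (leq_addl _ _) Mn) //.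
by move=> /le_lt_trans; apply; rewrite [ltRHS](splitr h) ltrD2r.
Qed.

(** The deviation e_n = x_n m^n - L/(m - r) satisfies e_(n+1) = (m/r) e_n + o(1).
    Powers of 1/2 tend to 0 in Archimedean fields only, hence the first
    assumption. *)
Lemma mulXsub_asymp (K : numFieldType) (m r L : K) (x : nat -> K) :
  (forall a : K, `|a| < 1 -> (fun n => `|a| ^+ n) @ \oo --> (0 : K)) ->
  `|m| < `|r| -> (fun n => mulXsub r x n * m ^+ n) @ \oo --> L ->
  (fun n => x n * m ^+ n) @ \oo --> L / (m - r).
Proof.
move=> geo mr xL.
have r0 : r != 0 by rewrite -normr_gt0 (le_lt_trans _ mr).
have mr0 : m - r != 0.
  by rewrite subr_eq0; apply/eqP => E; rewrite E ltxx in mr.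
have a1 : `|m / r| < 1 by rewrite normrM normfV ltr_pdivrMr ?mul1r ?normr_gt0.
pose e n := x n * m ^+ n - L / (m - r).
suff : e @ \oo --> (0 : K).
  have -> : (fun n => x n * m ^+ n) = e \+ cst (L / (m - r)).
    by apply/funext => n; rewrite /e /= subrK.
  by move=> e0; rewrite -[X in _ --> X]add0r; apply: cvgD => //; exact: cvg_cst.
apply: (cvg_contraction (d := fun n => (mulXsub r x n.+1 * m ^+ n.+1 - L) / - r) a1).
- exact: geo.
- move=> n; rewrite /e /mulXsub exprS; field.
  by rewrite mr0 r0.
- rewrite -(mul0r (- r)^-1) -(subrr L).
  apply: cvgM; last exact: cvg_cst.
  apply: cvgB; last exact: cvg_cst.
  by rewrite (cvg_shiftS (fun n => mulXsub r x n * m ^+ n)).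
Qed.

Lemma pconv_prod_asymp (K : numFieldType) (I : eqType) (s : seq I) (r : I -> K)
    (m L : K) (P : {poly K}) (x : nat -> K) :
  (forall a : K, `|a| < 1 -> (fun n => `|a| ^+ n) @ \oo --> (0 : K)) ->
  (forall j, j \in s -> `|m| < `|r j|) ->
  (fun n => pconv (\prod_(j <- s) ('X - (r j)%:P) * P) x n * m ^+ n) @ \oo --> L ->
  (fun n => pconv P x n * m ^+ n) @ \oo --> L * \prod_(j <- s) (m - r j)^-1.
Proof.
move=> geo; elim: s L => [|j s IHs] L mr; first by rewrite !big_nil mul1r mulr1.
rewrite !big_cons mulrA -mulrA => xL; apply: IHs => [i si|].
  by apply: mr; rewrite inE si orbT.
apply: mulXsub_asymp => //; first by apply: mr; rewrite inE eqxx.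
by move: xL; under eq_fun do rewrite pconvXsub.
Qed.

(** * Factors indexed by the roots of unity *)

(** The factorization of X^n - 1 evaluated at A/B, in the fraction field of the
    polynomials. *)
Lemma prod_sub_unity (F : fieldType) (n : nat) (z : F) (A B : {poly F}) :
  n.-primitive_root z -> B != 0 ->
  \prod_(0 <= i < n) (A - z ^+ i *: B) = A ^+ n - B ^+ n.
Proof.
move=> zn B0; apply/eqP; rewrite -tofrac_eq; apply/eqP.
pose f := @tofrac {poly F} \o polyC.
have fzn : n.-primitive_root (f z) by rewrite fmorph_primitive_root.
have B0' : tofrac B != 0 by rewrite tofrac_eq0.
have := congr1 (fun P => (P.[tofrac A / tofrac B] * tofrac B ^+ n)) (factor_Xn_sub_1 fzn).
rewrite !hornerE expr_div_n mulrBl mul1r divfK ?expf_neq0 //.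
rewrite rmorphB !rmorphXn /= => <-.
rewrite horner_prod -[in X in _ = _ * X](subn0 n) -prodr_const_nat -big_split /= rmorph_prod.
apply: eq_bigr => i _; rewrite !hornerE mulrBl divfK // -mul_polyC rmorphB rmorphM /=.
by rewrite polyC_exp rmorphXn.
Qed.

Lemma omegaX (R : realType) (l k : nat) :
  omega R l ^+ k = cos (2 * pi / l%:R *+ k) +i* sin (2 * pi / l%:R *+ k).
Proof.
elim: k => [|k IHk]; first by rewrite expr0 mulr0n cos0 sin0.
rewrite exprS IHk /omega (mulrS _ k) cosD sinD; simpc.
by congr (_ +i* _); rewrite addrC [cos _ * sin _]mulrC.
Qed.

(** If cos (2y) = 1 with y = pi k / l, then sin y = 0, impossible for 0 < y < pi. *)
Lemma omega_primitive (R : realType) (l : nat) : (1 <= l)%N -> l.-primitive_root (omega R l).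
Proof.
move=> l0; rewrite /primitive_root_of_unity l0 /=; apply/forallP => -[k kl] /=.
have lR : 0 < l%:R :> R by rewrite ltr0n.
apply/eqP; rewrite unity_rootE omegaX; apply/eqP/eqP => [[cosk _]|->]; last first.
  have -> : 2 * pi / l%:R *+ l = pi *+ 2 :> R by field; rewrite lt0r_neq0.
  by rewrite cos2pi sin2pi.
apply/eqP; rewrite eqn_leq kl /= leqNgt; apply/negP => kl'.
pose y : R := pi * k.+1%:R / l%:R.
have : 0 < sin y.
  apply: sin_gt0_pi; rewrite divr_gt0 ?mulr_gt0 ?pi_gt0 ?ltr0n //=.
  by rewrite ltr_pdivrMr // ltr_pM2l ?pi_gt0 // ltr_nat.
have yE : 2 * pi / l%:R *+ k.+1 = y *+ 2 by rewrite /y; field; rewrite lt0r_neq0.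
move: cosk; rewrite yE cos_mulr2n => cosk.
have : sin y ^+ 2 = 0 by rewrite sin2cos2; lra.
by move/eqP; rewrite sqrf_eq0 => /eqP ->; rewrite ltxx.
Qed.

Lemma omega_norm (R : realType) (l k : nat) : `|omega R l ^+ k| = 1.
Proof. by rewrite omegaX normc_def /= cos2Dsin2 sqrtr1. Qed.

(** * The quadratic polynomials *)

(** [s_poly] with any number [w] in place of the power of omega; below, [w] has
    modulus 1. *)
Definition quad (R : realType) (p q : R) (w : R[i]) : {poly R[i]} :=
  (p%:C *: 'X + (q%:C)%:P) ^+ 2 - w *: 'X.

Section Quad.
Variables (R : realType) (p q : R) (w : R[i]).
Hypotheses (p_gt0 : 0 < p) (pq1 : q = 1 - p) (ltpq : p < q) (w1 : `|w| = 1).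

(* The product of the two roots; the coefficient p^2 is invertible and the
   constant coefficient is q^2. *)
Let M : R := q ^+ 2 / p ^+ 2.

Let q_gt0 : 0 < q. Proof. exact: lt_trans ltpq. Qed.

Lemma quad_rootE z : root (quad p q w) z = ((p%:C * z + q%:C) ^+ 2 == w * z).
Proof. by rewrite rootE /quad !hornerE subr_eq0. Qed.

Lemma quad_bigroot_gt1 : 1 < M.
Proof. by rewrite /M ltr_pdivlMr ?exprn_gt0 // mul1r ltrXn2r // ltW. Qed.

Lemma quad_root_neq0 z : root (quad p q w) z -> z != 0.
Proof.
rewrite quad_rootE; apply: contraTneq => ->.
by rewrite !mulr0 add0r sqrf_eq0 fmorph_eq0 lt0r_neq0.
Qed.

(** Dividing (pa+q)^2 = w a by a expresses w through a; then compare
    coefficients. *)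
Lemma quad_factor a : root (quad p q w) a ->
  quad p q w = (p ^+ 2)%:C *: (('X - (M%:C / a)%:P) * ('X - a%:P)).
Proof.
move=> ra; have a0 := quad_root_neq0 ra.
have p0 : p%:C != 0 by rewrite fmorph_eq0 lt0r_neq0.
move: ra; rewrite quad_rootE => /eqP ra.
have wE : w = (p%:C * a + q%:C) ^+ 2 / a by rewrite ra mulfK.
have ME : M%:C = q%:C ^+ 2 / p%:C ^+ 2 by rewrite /M rmorphM fmorphV !rmorphXn.
have ab : (p ^+ 2)%:C * (M%:C / a * a) = q%:C ^+ 2.
  by rewrite ME rmorphXn /=; field; rewrite p0 a0.
have apb : (p ^+ 2)%:C * (M%:C / a + a) = w - (p%:C * q%:C) *+ 2.
  by rewrite ME wE rmorphXn /=; field; rewrite p0 a0.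
transitivity ((p ^+ 2)%:C *: 'X^2 - ((p ^+ 2)%:C * (M%:C / a + a)) *: 'X
              + ((p ^+ 2)%:C * (M%:C / a * a))%:P).
  rewrite ab apb /quad -!mul_polyC rmorphXn /=.
  by rewrite !(rmorphB, rmorphM, rmorphMn, rmorphXn) /=; ring.
rewrite -!mul_polyC !(rmorphD, rmorphM) /=; ring.
Qed.

(** With t = |z|, the triangle inequality gives t = |pz+q|^2 <= (pt+q)^2, and
    (pt+q)^2 - t = p^2 (t-1) (t-M). *)
Lemma quad_root_norm z : root (quad p q w) z ->
  exists t : R, [/\ `|z| = t%:C, 0 <= t & t <= 1 \/ M <= t].
Proof.
move=> rz; exists (complex.Re `|z|).
have zE : `|z| = (complex.Re `|z|)%:C by rewrite normc_def.
set t := complex.Re _ in zE *.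
have t0 : 0 <= t by rewrite -ler0c -zE.
split=> //.
have h : t <= (p * t + q) ^+ 2.
  move: rz; rewrite quad_rootE => /eqP /(congr1 Num.norm).
  rewrite normrX normrM w1 mul1r zE => zt.
  rewrite -lecR -zt rmorphXn /= lerXn2r ?nnegrE ?normr_ge0 //.
    by rewrite ler0c addr_ge0 ?mulr_ge0 // ltW.
  apply: (le_trans (ler_normD _ _)); rewrite normrM zE !normc_def /= expr0n /= !addr0.
  by rewrite !sqrtr_sqr !gtr0_norm // rmorphD rmorphM.
have : 0 <= (t - 1) * (t - M).
  have -> : (t - 1) * (t - M) = ((p * t + q) ^+ 2 - t) / p ^+ 2.
    by rewrite /M pq1; field; rewrite lt0r_neq0.
  by rewrite divr_ge0 ?sqr_ge0 // subr_ge0.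
case: (lerP t 1) => [|t1]; first by left.
by rewrite pmulr_rge0 ?subr_gt0 // subr_ge0; right.
Qed.

Lemma quad_largest_ex : exists z, largest_root (quad p q w) z.
Proof.
(* the quadratic formula *)
have [a ra] : exists a, root (quad p q w) a.
  pose b := w - (p%:C * q%:C) *+ 2; pose d := sqrtC (b ^+ 2 - (p%:C * q%:C) ^+ 2 *+ 4).
  have dE : d ^+ 2 = b ^+ 2 - (p%:C * q%:C) ^+ 2 *+ 4 by rewrite sqrtCK.
  exists ((b + d) / (p%:C ^+ 2 *+ 2)); rewrite quad_rootE -subr_eq0.
  have p0 : p%:C != 0 by rewrite fmorph_eq0 lt0r_neq0.
  apply/eqP; transitivity ((d ^+ 2 - (b ^+ 2 - (p%:C * q%:C) ^+ 2 *+ 4)) / (p%:C ^+ 2 *+ 4)).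
    by rewrite /b; field.
  by rewrite dE subrr mul0r.
have E := quad_factor ra.
have rE z : root (quad p q w) z = (z == M%:C / a) || (z == a).
  rewrite E rootZ ?rootM ?root_XsubC //.
  by rewrite fmorph_eq0 expf_neq0 ?lt0r_neq0.
have [ab|ba] := real_leP (normr_real (M%:C / a)) (normr_real a).
- exists a; split=> // z; rewrite rE => /orP[] /eqP -> //.
- exists (M%:C / a); split=> [|z]; first by rewrite rE eqxx.
  by rewrite rE => /orP[] /eqP -> //; exact: ltW.
Qed.

(** The other root is M/z, so |z|^2 >= M > 1; this excludes |z| <= 1. *)
Lemma quad_largest_norm z : largest_root (quad p q w) z -> M%:C <= `|z|.
Proof.
move=> [rz zmax]; have [t [zt t0 tM]] := quad_root_norm rz.
have z0 := quad_root_neq0 rz.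
have /zmax : root (quad p q w) (M%:C / z).
  by rewrite (quad_factor rz) rootZ ?rootM ?root_XsubC ?eqxx //
     fmorph_eq0 expf_neq0 ?lt0r_neq0.
rewrite normrM normfV ler_pdivrMr ?normr_gt0 // zt -rmorphM normc_def /= expr0n /= addr0.
have M1 := quad_bigroot_gt1.
rewrite sqrtr_sqr gtr0_norm ?(lt_trans _ M1) // !lecR => Mt.
by case: tM => // t1; nra.
Qed.

(** Here |pz+q| = q/p = p|z| + q, so the triangle inequality is an equality and
    z is a positive real, which leaves w = 1. *)
Lemma quad_largest_norm_eq z : root (quad p q w) z -> `|z| = M%:C -> w = 1.
Proof.
move=> rz zM.
have M0 : 0 < M := lt_trans ltr01 quad_bigroot_gt1.
have pMq : p * M + q = q / p by rewrite /M pq1; field; rewrite lt0r_neq0.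
have Re_norm (x : R) : 0 <= x -> `|x%:C| = x%:C.
  by move=> x0; rewrite ger0_norm ?ler0c.
have nz : `|p%:C * z + q%:C| = `|p%:C * z| + `|q%:C|.
  apply: (@pexpIrn _ 2); rewrite ?nnegrE ?addr_ge0 //.
  rewrite -normrX; move: rz; rewrite quad_rootE => /eqP ->.
  rewrite !normrM w1 zM mul1r !Re_norm ?ltW // -rmorphM -rmorphD pMq -rmorphXn /=.
  by rewrite expr_div_n.
have [t /eqP t1 [pz qt]] := normCDeq nz.
have q0 : q%:C != 0 by rewrite fmorph_eq0 lt0r_neq0.
have p0 : p%:C != 0 by rewrite fmorph_eq0 lt0r_neq0.
have tE : t = 1.
  by apply: (mulfI q0); rewrite mulr1 [RHS]qt Re_norm // ltW.
move: pz; rewrite tE mulr1 normrM zM Re_norm ?ltW // => /(mulfI p0) zE.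
move: rz; rewrite quad_rootE zE -rmorphM -rmorphD pMq -rmorphXn /= expr_div_n => /eqP.
by rewrite -[LHS]mul1r => /mulIf -> //; rewrite fmorph_eq0 lt0r_neq0.
Qed.

End Quad.

(** * The chain *)

Lemma coef_step (R : realType) (l : nat) (p q : R) (k : nat) :
  ((p *: 'X + q%:P) ^+ l.*2)`_k = step l p q (k%:Z - l%:Z).
Proof.
rewrite addrC exprDn coef_sum.
have coefE (i : 'I_l.*2.+1) :
  (q%:P ^+ (l.*2 - i) * (p *: 'X) ^+ i *+ 'C(l.*2, i))`_k
    = if i == k :> nat then 'C(l.*2, i)%:R * p ^+ i * q ^+ (l.*2 - i) else 0.
  rewrite coefMn -polyC_exp coefCM exprZn coefZ coefXn eq_sym.
  case: eqP => _; last by rewrite !mulr0 mul0rn.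
  by rewrite mulr1 -[LHS]mulr_natl; ring.
rewrite (eq_bigr _ (fun i _ => coefE i)) /step.
have [kl|lk] := leqP k l.*2.
  rewrite (bigD1 (Ordinal (kl : (k < l.*2.+1)%N))) //= eqxx big1 ?addr0 => [|i]; last first.
    by rewrite -val_eqE /= => /negPf ->.
  rewrite ifT; last by lia.
  have -> : absz (l%:Z + (k%:Z - l%:Z)) = k by lia.
  by have -> : absz (l%:Z - (k%:Z - l%:Z))%R = (l.*2 - k)%N by lia.
rewrite big1 => [|i _]; first by rewrite ifF //; lia.
by case: eqP => // ik; have := ltn_ord i; lia.
Qed.

(** The balance equation at the state n - l > 0, where [trans] is given by
    [step] alone. *)
Lemma stationary_pconv (R : realType) (l : nat) (p q : R) (w : nat -> R) (n : nat) :
  stationary_distribution (trans l p q) w -> (l < n)%N ->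
  pconv ((p *: 'X + q%:P) ^+ l.*2) w n = w (n - l)%N.
Proof.
move=> [_ _ stw] ln.
have m_gt0 : (0 < n - l)%N by rewrite subn_gt0.
have transE i : trans l p q i (n - l)%N = step l p q ((n - l)%N%:Z - i%:Z).
  by case: (n - l)%N m_gt0.
rewrite -(series_eventually0 (N := n.+1) (stw (n - l)%N)) => [|i ni]; last first.
  by rewrite transE /step ifF ?mulr0 //; lia.
rewrite /pconv (reindex_inj rev_ord_inj) /=; apply: eq_bigr => i _.
rewrite subSS subKn -1?ltnS // mulrC transE coef_step.
by congr (_ * step _ _ _ _); have := ltn_ord i; lia.
Qed.

Lemma pconv_map (K L : nzRingType) (f : {rmorphism K -> L}) (P : {poly K})
    (x : nat -> K) (n : nat) :
  pconv (map_poly f P) (f \o x) n = f (pconv P x n).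
Proof. by rewrite rmorph_sum; apply: eq_bigr => k _; rewrite coef_map rmorphM. Qed.

Section Main.
Variables (R : realType) (l : nat) (p q : R).
Hypotheses (hl : (1 <= l)%N) (hp : 0 < p) (hq : q = 1 - p) (hpq : p < q).
Let M : R := q ^+ 2 / p ^+ 2.

Lemma mu_largest j : largest_root (quad p q (omega R l ^+ j.-1)) (mu l p q j).
Proof. by apply: xgetPex; apply: quad_largest_ex => //; exact: omega_norm. Qed.

Lemma mu_ge j : M%:C <= `|mu l p q j|.
Proof. by apply: (quad_largest_norm hp hq hpq _ (mu_largest j)); exact: omega_norm. Qed.

Lemma bigroot_gt1 : 1 < M%:C.
Proof. by rewrite -[1]/(1%:C) ltcR quad_bigroot_gt1. Qed.

Lemma mu_gt1 j : 1 < `|mu l p q j|.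
Proof. exact: lt_le_trans bigroot_gt1 (mu_ge j). Qed.

(** 1 is a root of the first quadratic, so the other one is M. *)
Lemma mu_first : mu l p q 1 = M%:C.
Proof.
have w1 : `|1 : R[i]| = 1 by exact: normr1.
have r1 : root (quad p q 1) 1.
  by rewrite quad_rootE !mulr1 -rmorphD hq addrC subrK expr1n.
have := (mu_largest 1).1; rewrite expr0 (quad_factor hp hpq r1).
rewrite rootZ ?rootM ?root_XsubC ?divr1 => [/orP[/eqP //|/eqP E]|].
  by have := mu_gt1 1; rewrite E normr1 ltxx.
by rewrite fmorph_eq0 expf_neq0 ?lt0r_neq0.
Qed.

(** Equal moduli would force omega^(j-1) = 1, but omega is a primitive l-th
    root of unity. *)
Lemma mu_gt_first j : (2 <= j <= l)%N -> `|mu l p q 1| < `|mu l p q j|.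
Proof.
move=> /andP[j2 jl]; rewrite mu_first ger0_norm ?(le_trans ler01) ?ltW ?bigroot_gt1 //.
rewrite lt_def mu_ge andbT; apply/eqP => E.
have := quad_largest_norm_eq hp hq hpq (omega_norm R l j.-1) (mu_largest j).1 E.
move/eqP; rewrite -(prim_order_dvd (omega_primitive R hl)) => /dvdn_leq; lia.
Qed.

(** The inner root attached to mu_j is M / mu_j. *)
Lemma charpoly_factor :
  (p%:C *: 'X + (q%:C)%:P) ^+ l.*2 - 'X^l
  = ((p ^+ 2)%:C ^+ l) *:
    (\prod_(1 <= j < l.+1) ('X - (M%:C / mu l p q j)%:P)
     * \prod_(1 <= j < l.+1) ('X - (mu l p q j)%:P)).
Proof.
transitivity (\prod_(1 <= j < l.+1) quad p q (omega R l ^+ j.-1)).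
  rewrite big_add1 /= -muln2 mulnC exprM.
  by rewrite -(prod_sub_unity _ (omega_primitive R hl)) ?polyX_eq0.
rewrite -big_split /= -mul_polyC polyC_exp -[l in _ ^+ l]subn0 -(subSS 0 l).
rewrite -prodr_const_nat -big_split; apply: eq_bigr => j _.
by rewrite (quad_factor hp hpq (mu_largest j).1) /= mul_polyC.
Qed.

End Main.

Theorem mainTheorem6 (R : realType) (l : nat) (p q rho : R) (w : nat -> R)
  (hl : (1 <= l)%N) (hp : 0 < p) (hq : q = 1 - p) (hpq : p < q)
  (hrho : rho = p / q)
  (hw : stationary_distribution (trans l p q) w) :
  asymp_equiv (fun n : nat => (w n)%:C)
              (fun n : nat => c_const l p q * (rho ^+ (2 * n)%N)%:C).
Proof.
pose x n : Cfield R := (w n)%:C.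
pose mu j : Cfield R := mu l p q j.
pose m := mu 1%N.
pose Q := \prod_(1 <= j < l.+1) ('X - (mu j)%:P).
have [_ w_sum _] := hw.
have x_sum : series x @ \oo --> (1 : Cfield R).
  have -> : series x = (fun n => (series w n)%:C).
    by apply/funext => n; rewrite /series /= rmorph_sum.
  exact: cvg_real_complex w_sum.
have x0 : x @ \oo --> (0 : Cfield R).
  by apply: cvg_series_cvg_0; apply: cvgP x_sum.
have mE : m = (q ^+ 2 / p ^+ 2)%:C by exact: mu_first.
have geo (a : Cfield R) : `|a| < 1 -> (fun n => `|a| ^+ n) @ \oo --> (0 : Cfield R).
  exact: cvg_expC.
have p0 : (p ^+ 2)%:C != 0.
  by rewrite fmorph_eq0 expf_neq0 ?lt0r_neq0.
have m0 : m != 0 by rewrite -normr_gt0 (lt_trans ltr01) ?mu_gt1.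
(* the roots in the unit disc *)
pose lam j : Cfield R := (q ^+ 2 / p ^+ 2)%:C / mu j.
have lam1 j : `|lam j| <= 1.
  rewrite normrM normfV -mE ler_pdivrMr ?mul1r ?(lt_trans ltr01) ?mu_gt1 //.
  by rewrite mE ger0_norm ?mu_ge // (le_trans ler01) // ltW ?bigroot_gt1.
(* Cancelling the l inner roots: the full product vanishes beyond degree l,
   hence Q times the generating function vanishes beyond degree 0. *)
have Qx n : (1 <= n)%N -> pconv Q x n = 0.
  move: n; apply: (pconv_prod_eq0 (s := index_iota 1 l.+1) lam1).
    by rewrite -(mulr1 Q); apply: cvg_pconv_prod; rewrite pconv1.
  move=> n; rewrite size_iota subSS subn0 add1n => ln.
  apply: (mulfI (expf_neq0 l p0)); rewrite mulr0 -pconvZ -charpoly_factor //.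
  rewrite pconvB pconvXn ?(ltnW ln) //.
  have -> : (p%:C *: 'X + (q%:C)%:P) ^+ l.*2
      = map_poly (real_complex R) ((p *: 'X + q%:P) ^+ l.*2).
    by rewrite rmorphXn rmorphD /= map_polyZ map_polyX map_polyC.
  by rewrite (pconv_map _ _ w) (stationary_pconv hw ln) subrr.
have Qx0 : pconv Q x 0%N = \prod_(1 <= j < l.+1) (1 - mu j).
  rewrite -[RHS]mulr1 -(series_eventually0 (series_pconv_prod x_sum) Qx).
  by rewrite big_ord1.
(* Keeping the factor of mu_1 for the end leaves a geometric sequence. *)
pose y := pconv (\prod_(2 <= j < l.+1) ('X - (mu j)%:P)) x.
have QE n : pconv Q x n = mulXsub m y n by rewrite /Q big_ltn // pconvXsub.
have y_geom n : y n * m ^+ n = - pconv Q x 0%N / m.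
  by apply: mulXsub_geometric => [||k k1]; rewrite // -QE // Qx.
pose c : Cfield R := c_const l p q.
have cE : c = - pconv Q x 0%N / m * \prod_(2 <= j < l.+1) (m - mu j)^-1.
  rewrite /c /c_const -/(mu 1%N) -/m big_split /= Qx0 (big_ltn (m := 1) (n := l.+1)) //.
  have alg (K : fieldType) (a P I : K) : (a - 1) / a * (P * I) = - ((1 - a) * P) / a * I.
    by ring.
  by rewrite alg.
have xm : (fun n => x n * m ^+ n) @ \oo --> c.
  have xE : pconv 1 x = x by exact: pconv1.
  have mu_gt j : j \in index_iota 2 l.+1 -> `|m| < `|mu j|.
    by rewrite mem_index_iota => jl; apply: mu_gt_first.
  have y_lim : (fun n => pconv (\prod_(2 <= j < l.+1) ('X - (mu j)%:P) * 1) x n * m ^+ n)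
      @ \oo --> - pconv Q x 0%N / m.
    by rewrite mulr1 (funext y_geom); exact: cvg_cst.
  by have := pconv_prod_asymp geo mu_gt y_lim; rewrite xE cE; exact.
have mu1 j : 1 - mu j != 0.
  rewrite subr_eq0; apply/eqP => E.
  by have := mu_gt1 l hp hq hpq j; rewrite -/(mu j) -E normr1 ltxx.
have c0 : c != 0.
  rewrite cE Qx0 mulf_neq0 ?mulf_neq0 ?oppr_eq0 ?invr_eq0 //.
    by rewrite prodf_seq_neq0; apply/allP => j _ /=.
  rewrite prodf_seq_neq0; apply/allP => j; rewrite mem_index_iota => jl /=.
  rewrite invr_eq0 subr_eq0; apply/eqP => E.
  by have := mu_gt_first hl hp hq hpq jl; rewrite -/m -/(mu j) -E ltxx.
have rho_m n : ((rho ^+ (2 * n))%:C : Cfield R) = (m ^+ n)^-1.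
  rewrite mE -rmorphXn -fmorphV /= -exprVn; congr (_%:C).
  by rewrite exprM; congr (_ ^+ _); rewrite hrho invf_div expr_div_n.
have lim1 : (fun n => x n * m ^+ n / c) @ \oo --> c / c.
  by apply: cvgM; [exact: xm | exact: cvg_cst].
rewrite (divff c0) in lim1.
rewrite /asymp_equiv.
have -> : (fun n => (w n)%:C / (c_const l p q * (rho ^+ (2 * n))%:C)) =
          (fun n => x n * m ^+ n / c).
  apply/funext => n; rewrite rho_m -/c -/(x n) invfM invrK mulrCA mulrC; reflexivity.
exact: lim1.
Qed.
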